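(* There exists a universal constant $C > 0$ such that the following holds. Let $N, n \ge 1$ be integers and let $\{Y_i\}_{i=1}^{\infty}$ be a stationary reversible Markov chain with state space $[N]$, transition matrix $A$, stationary probability measure $\mu$ (so that $Y_1$ is distributed according to $\mu$) and averaging operator $E_\mu$, and let $\lambda = \|A - E_\mu\|_{L_2(\mu)\to L_2(\mu)}$. Let $f_1, \ldots, f_n : [N] \to \{-1,1\}$ be functions such that $\mathbb{E}[f_i(Y_i)] = 0$ for every $i$. Then for all distinct integers $v_1, \ldots, v_n \ge 1$ and every $x_0 \in \mathbb{Z}$, $$\Pr[f_1(Y_1)v_1 + f_2(Y_2)v_2 + \cdots + f_n(Y_n)v_n = x_0] \le \frac{C}{(1-\lambda)^3 n^{3/2}}.$$
   Context: $[N] = \{1,\ldots,N\}$. The chain has transition matrix $A \in \mathbb{R}^{N\times N}$ (a stochastic matrix), with $\Pr[Y_{i+1} = b \mid Y_i = a] = A_{ab}$; reversible means $\mu_a A_{ab} = \mu_b A_{ba}$ for all $a,b \in [N]$; stationary means $Y_1$ (hence every $Y_i$) has distribution $\mu$. The averaging operator $E_\mu$ is the $N\times N$ matrix with entries $(E_\mu)_{ij} = \mu_j$. For $v$ a vector indexed by $[N]$, $\|v\|_{L_2(\mu)}^2 = \sum_{i=1}^N |v_i|^2\mu_i$, and $\|M\|_{L_2(\mu)\to L_2(\mu)} = \max_{v : \|v\|_{L_2(\mu)} = 1} \|Mv\|_{L_2(\mu)}$. ''Universal constant'' means a constant independent of all other data ($N, n$, the chain, the $f_i$, the $v_i$, $x_0$).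 One always has $0 \le \lambda \le 1$; when $\lambda = 1$ the right-hand side is read as $+\infty$. *)

(* Defs.v *)
From mathcomp Require Import all_boot all_order all_algebra.
From mathcomp Require Import all_classical all_reals all_analysis.

Set Implicit Arguments.
Unset Strict Implicit.
Unset Printing Implicit Defensive.

Import Order.TTheory GRing.Theory Num.Theory.
Import numFieldNormedType.Exports.

Local Open Scope classical_set_scope.
Local Open Scope ring_scope.

(* Measurability for the discrete sigma-algebra on the finite state space
   (stated by hand, since 'I_N is not a pointed type for arbitrary N). *)
Definition discrete_rv d (T : measurableType d) N (X : T -> 'I_N) : Prop :=
  forall a, measurable [set t | X t = a].

(* When P F = 0 this is 0 * +oo = 0 by the conventions of \bar R; it is only
   used below on conditioning events of nonzero probability. *)
Definition cond_prob d (T : measurableType d) (R : realType)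
    (P : probability T R) (E F : set T) : \bar R :=
  (P (E `&` F) / P F)%E.

Definition stochastic (R : realType) N (A : 'M[R]_N) : Prop :=
  (forall a b, 0 <= A a b) /\ (forall a, \sum_b A a b = 1).

Definition prob_vector (R : realType) N (mu : 'I_N -> R) : Prop :=
  (forall a, 0 <= mu a) /\ \sum_a mu a = 1.

Definition reversible (R : realType) N (A : 'M[R]_N) (mu : 'I_N -> R) : Prop :=
  forall a b, mu a * A a b = mu b * A b a.

(* Time is shifted by one: [Y 0] is the variable written Y_1 informally. *)
Definition markov_chain d (T : measurableType d) (R : realType)
    (P : probability T R) N (Y : nat -> T -> 'I_N) (A : 'M[R]_N) : Prop :=
  forall (k : nat) (a : nat -> 'I_N) (b : 'I_N),
    let past := [set t | forall j, (j <= k)%N -> Y j t = a j] in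
    P past != 0%E ->
    cond_prob P [set t | Y k.+1 t = b] past = (A (a k) b)%:E.

(* With reversibility, the law of [Y 0] being [mu] makes every [Y i] have
   law [mu]. *)
Record stationary_reversible_chain d (T : measurableType d) (R : realType)
    (P : probability T R) N (Y : nat -> T -> 'I_N) (A : 'M[R]_N)
    (mu : 'I_N -> R) : Prop := {
  src_rv : forall i, discrete_rv (Y i);
  src_stochastic : stochastic A;
  src_prob : prob_vector mu;
  src_reversible : reversible A mu;
  src_markov : markov_chain P Y A;
  src_initial : forall a, P [set t | Y 0%N t = a] = (mu a)%:E
}.

Definition averaging (R : realType) N (mu : 'I_N -> R) : 'M[R]_N :=
  \matrix_(i, j) mu j.

Definition L2norm (R : realType) N (mu : 'I_N -> R) (v : 'cV[R]_N) : R :=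
  Num.sqrt (\sum_i `|v i 0| ^+ 2 * mu i).

(* The informal maximum is rendered by [sup], which is 0 on an unbounded set.
   For M = A - averaging mu with A stochastic and reversible for mu, the
   set is bounded even if mu vanishes at some states: mu a != 0 and mu b = 0
   force A a b = 0, so the seminorm of M v depends only on v over the support
   of mu. *)
Definition L2opnorm (R : realType) N (mu : 'I_N -> R) (M : 'M[R]_N) : R :=
  sup [set L2norm mu (M *m v) | v in [set v | L2norm mu v = 1]].

(* Main.v *)
Require Import Defs.
From mathcomp Require Import all_boot all_order all_algebra.
From mathcomp Require Import all_classical all_reals all_analysis.
From mathcomp Require Import ring lra zify.

(** The proof is Halasz' argument, with the circle replaced by a finite cyclic
group of prime order so that only finite sums occur.

Write [S] for the random sum, let [p] be a prime exceeding [2 n ^ 2] and all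
[2 v_i], and expand the indicator of [S = x0] in characters of [Z/p]:
the probability is at most the average over [theta] in [Z/p] of
[E cos (2 pi theta (x0 - S) / p)].  Two estimates finish the proof.

Spectral estimate.  Conditioning backwards in time turns the cosine and the
companion sine into a pair of functions on the states; one step of time applies
the transition matrix to both and then, at each state, rotates the pair by the
angle [2 pi theta f_i v_i / p].  The transition matrix keeps the mean of a
function and multiplies its variance by at most [lambda ^ 2].  As [f_i] has mean
zero, the rotation turns a constant function into one that keeps a proportion
[sin ^ 2] of its mass in the mean-zero part, and this part is what the transition
matrix shrinks.  Shrinkage is measured by [mean ^ 2 + lambda * variance], which
amounts to giving half of each transition step to either of the two neighbouring
rotations: each step multiplies it by at most
[1 - (1 - lambda) sin ^ 2 / 3] ([potential_step]).  Hence the expected cosine is at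
most [exp (- (1 - lambda) G(theta) / 6)], where [G(theta)] is the sum over [j] of
[sin ^ 2 (2 pi theta v_j / p)]; the bound is used in the weaker form
[144 / (1 - lambda) ^ 2 / (1 + G(theta)) ^ 2] ([mean_backward_cos]).

Arithmetic estimate.  The average of [1 / (1 + G) ^ 2] is of order
[n ^ (- 3 / 2)] ([sum_inv_energy]).  Since the [v_j] are distinct up to sign modulo
[p], orthogonality gives that [G <= n / 8] holds for a proportion at most
[8 / (9 n)] of the residues ([card_level_base]).  The square root of [G] is
subadditive, so a [k]-fold sum of residues with [G <= n / (8 k ^ 2)] has
[G <= n / 8]; by the Cauchy-Davenport theorem the [k]-fold sumset is about [k]
times as large as the set, which bounds the level sets by a proportion of order
[1 / (k n)] ([card_level]).  Summing over the levels [k] up to about [sqrt n] gives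
the claim.

Together these yield the exponent 2 for [1 - lambda]; the exponent 3 follows from
[0 <= lambda <= 1]. *)

Set Implicit Arguments.
Unset Strict Implicit.
Unset Printing Implicit Defensive.

Import Order.TTheory GRing.Theory Num.Theory.
Import numFieldNormedType.Exports.

Local Open Scope classical_set_scope.
Local Open Scope ring_scope.

(** * Cauchy-Davenport *)

Section CauchyDavenport.
Variable p : nat.
Hypothesis p_prime : prime p.

Lemma Fp_natmul_inv (x d : 'F_p) : d != 0 -> exists m : nat, x = d *+ m.
Proof.
move=> d0; exists (val (x / d : 'F_p)).
by rewrite -mulr_natr natr_Zp mulrC divfK.
Qed.

Lemma translate_closed_setT (A : {set 'F_p}) (a d : 'F_p) :
  a \in A -> d != 0 -> (forall x, x \in A -> x + d \in A) -> A = [set: 'F_p]%SET.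
Proof.
move=> aA d0 cl; apply/finset.setP => y; rewrite inE.
have [m] := Fp_natmul_inv (y - a) d0; move/eqP; rewrite subr_eq => /eqP ->.
elim: m => [|m IH]; first by rewrite mulr0n add0r.
by rewrite mulrSr addrAC cl.
Qed.

Definition sumset (A B : {set 'F_p}) : {set 'F_p} :=
  [set x + y | x in A, y in B]%SET.

(** Induction on [#|B|] by the Dyson transform: replacing [A] by its union with a
translate of [B], and [B] by the matching intersection, keeps the sum of the
cardinals and does not enlarge the sumset.  Unless [A] is everything, some
translate makes the intersection nonempty and smaller than [B], because a set
stable under translation by a nonzero residue is everything. *)
Lemma cauchy_davenport (A B : {set 'F_p}) :
  A != finset.set0 -> B != finset.set0 ->
  (minn p (#|A| + #|B|).-1 <= #|sumset A B|)%N.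
Proof.
have [k] := ubnP #|B|; elim: k A B => // k IH A B ltBk A0 B0.
have [->|AT] := eqVneq A [set: 'F_p]%SET.
  have [b bB] := finset.set0Pn _ B0.
  apply: leq_trans (geq_minl _ _) _.
  have -> : sumset [set: 'F_p]%SET B = [set: 'F_p]%SET.
    apply/finset.setP => x; rewrite finset.in_setT; apply/finset.imset2P.
    by exists (x - b) b => //; rewrite subrK.
  by rewrite cardsT card_Fp.
have [B1|B2] := leqP #|B| 1.
  have [b bB] := finset.set0Pn _ B0.
  have : #|B| = 1%N by apply/eqP; rewrite eqn_leq B1 card_gt0.
  move=> cB; rewrite cB addn1 /=; apply: leq_trans (geq_minr _ _) _.
  rewrite -(card_imset (mem A) (addIr b)); apply: subset_leq_card.
  apply/fintype.subsetP => _ /imsetP[x xA ->]; apply/finset.imset2P; by exists x b.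
have [b1 [b2 [b1B b2B b12]]] := card_gt1P B2.
have [a aA nad] : exists2 a, a \in A & a + (b2 - b1) \notin A.
  have [a0 a0A] := finset.set0Pn _ A0.
  apply/exists_inP; apply: contraNT AT; rewrite negb_exists_in => /forall_inP cl.
  apply/eqP; apply: (translate_closed_setT (d := b2 - b1) a0A).
    by rewrite subr_eq0 eq_sym.
  by move=> x /cl; rewrite negbK.
pose e := a - b1.
pose C := [set b + e | b in B]%SET.
pose B' := [set b in B | b + e \in A]%SET.
have cC : #|C| = #|B| by rewrite card_imset //; exact: addIr.
have cB' : #|B'| = #|A :&: C|.
  rewrite -(card_imset (mem B') (addIr e)); apply: eq_card => x.
  apply/imsetP/finset.setIP => [[b]|[xA /imsetP[b bB xE]]].
    by rewrite inE => /andP[bB beA] ->; split=> //; apply/imsetP; exists b.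
  by exists b => //; rewrite inE bB -xE.
have b1B' : b1 \in B' by rewrite inE b1B /e addrC subrK.
have ltB' : (#|B'| < #|B|)%N.
  apply: proper_card; apply/fintype.properP; split.
    by apply/fintype.subsetP => x; rewrite inE => /andP[].
  exists b2 => //; rewrite inE b2B /= /e.
  by have -> : b2 + (a - b1) = a + (b2 - b1) by rewrite addrCA.
have eqc : (#|A :|: C| + #|B'| = #|A| + #|B|)%N by rewrite cB' cardsUI cC.
have AC0 : A :|: C != finset.set0.
  have [a0 a0A] := finset.set0Pn _ A0.
  by apply/finset.set0Pn; exists a0; rewrite inE a0A.
have B'0 : B' != finset.set0 by apply/finset.set0Pn; exists b1.
have {IH} := IH (A :|: C) B' (leq_trans ltB' ltBk) AC0 B'0.
rewrite eqc => /leq_trans; apply.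
apply: subset_leq_card; apply/fintype.subsetP => _ /finset.imset2P[x y xAC yB' ->].
move: yB'; rewrite inE => /andP[yB yeA].
move: xAC; rewrite inE => /orP[xA|/imsetP[b bB ->]]; apply/finset.imset2P.
  by exists x y.
by exists (y + e) b => //; rewrite addrC addrA addrAC.
Qed.

(** [iter k (sumset A) A] is the sumset of [k.+1] copies of [A]. *)
Lemma card_iter_sumset (A : {set 'F_p}) k : A != finset.set0 ->
  (minn p (k.+1 * #|A|.-1).+1 <= #|iter k (sumset A) A|)%N.
Proof.
move=> A0; have cA : (0 < #|A|)%N by rewrite card_gt0.
elim: k => [|k IH] /=.
  by apply: leq_trans (geq_minr _ _) _; rewrite mul1n prednK.
have B0 : iter k (sumset A) A != finset.set0.
  rewrite -card_gt0; apply: leq_trans IH.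
  by rewrite leq_min prime_gt0.
have := cauchy_davenport A0 B0; move: IH cA.
set b := #|iter k (sumset A) A|; set c := #|sumset A _|; set a := #|A|; rewrite mulSn.
by move: (k.+1 * a.-1)%N => m; lia.
Qed.

End CauchyDavenport.

(** * Characters of the integers modulo a prime *)

Section Characters.
Variables (R : realType) (p : nat).
Hypothesis p_prime : prime p.

Definition cosF (x : 'F_p) : R := cos (pi *+ 2 / p%:R * (x : nat)%:R).
Definition sinF (x : 'F_p) : R := sin (pi *+ 2 / p%:R * (x : nat)%:R).

Lemma cosF_sinF_D (x y : 'F_p) :
  cosF (x + y) = cosF x * cosF y - sinF x * sinF y /\
  sinF (x + y) = sinF x * cosF y + cosF x * sinF y.
Proof.
rewrite /cosF /sinF -cosD -sinD -mulrDr -natrD.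
have p0 : (p%:R : R) != 0 by rewrite pnatr_eq0 -lt0n prime_gt0.
have -> : ((x + y)%R : nat) = ((x + y) %% p)%N :> nat.
  have E : x + y = (x + y)%N%:R by rewrite natrD !natr_Zp.
  by rewrite E val_Fp_nat.
have -> : (x + y)%N%:R = ((x + y) %/ p)%:R * p%:R + ((x + y) %% p)%:R :> R.
  by rewrite {1}(divn_eq (x + y) p) natrD natrM.
rewrite mulrDr.
have -> : pi *+ 2 / p%:R * (((x + y) %/ p)%:R * p%:R) = pi *+ 2 *+ ((x + y) %/ p) :> R.
  by rewrite -[in RHS]mulr_natr; field.
by rewrite [_ *+ _ + _]addrC !(periodicn (@cosD2pi R)) !(periodicn (@sinD2pi R)).
Qed.

Lemma cosFD x y : cosF (x + y) = cosF x * cosF y - sinF x * sinF y.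
Proof. by case: (cosF_sinF_D x y). Qed.
Lemma sinFD x y : sinF (x + y) = sinF x * cosF y + cosF x * sinF y.
Proof. by case: (cosF_sinF_D x y). Qed.

Lemma cosF0 : cosF 0 = 1. Proof. by rewrite /cosF mulr0 cos0. Qed.
Lemma sinF0 : sinF 0 = 0. Proof. by rewrite /sinF mulr0 sin0. Qed.

Lemma cosF2DsinF2 x : cosF x ^+ 2 + sinF x ^+ 2 = 1.
Proof. exact: cos2Dsin2. Qed.

Lemma cosFN x : cosF (- x) = cosF x.
Proof.
have := cosFD x (- x); have := sinFD x (- x).
rewrite subrr cosF0 sinF0; have := cosF2DsinF2 x.
set c := cosF x; set s := sinF x; set c' := cosF _; set s' := sinF _ => h h1 h2.
have : c' * (c ^+ 2 + s ^+ 2) = c * (c * c' - s * s') + s * (s * c' + c * s') by ring.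
by rewrite h -h1 -h2 !mulr1 mulr0 addr0.
Qed.

Lemma sinFN x : sinF (- x) = - sinF x.
Proof.
have := cosFD x (- x); have := sinFD x (- x).
rewrite subrr cosF0 sinF0; have := cosF2DsinF2 x.
set c := cosF x; set s := sinF x; set c' := cosF _; set s' := sinF _ => h h1 h2.
have : s' * (c ^+ 2 + s ^+ 2) = c * (s * c' + c * s') - s * (c * c' - s * s') by ring.
by rewrite h -h1 -h2 !mulr1 mulr0 sub0r.
Qed.

(** By the double angle formula this reduces to [sin (pi x / p) > 0]. *)
Lemma cosF_neq1 x : x != 0 -> cosF x != 1.
Proof.
move=> x0; rewrite /cosF.
have p0 : (0 < p%:R :> R) by rewrite ltr0n prime_gt0.
pose z : R := pi * ((x : nat)%:R / p%:R).
have -> : pi *+ 2 / p%:R * (x : nat)%:R = z *+ 2.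
  by rewrite /z !mulr2n; field; rewrite gt_eqF.
have zs : 0 < sin z.
  apply: sin_gt0_pi; apply/andP; split.
    rewrite mulr_gt0 ?pi_gt0// divr_gt0 // ltr0n lt0n.
    by apply: contraNneq x0 => x0; apply/eqP/val_inj.
  rewrite -[ltRHS]mulr1 /z ltr_pM2l ?pi_gt0 // ltr_pdivrMr // mul1r ltr_nat.
  by rewrite -{2}(Fp_cast p_prime) ltn_ord.
rewrite cos_mulr2n; have := cos2Dsin2 z => h; apply/eqP => h2.
have : sin z ^+ 2 > 0 by rewrite exprn_gt0.
move: h h2; rewrite -mulr_natr; lra.
Qed.

(** Translating the summation variable by 1 rotates the vector of the two sums of
[cosF (a * x)] and [sinF (a * x)] by a nontrivial angle, so this vector is 0. *)
Lemma sum_cosF a : a != 0 -> \sum_(x : 'F_p) cosF (a * x) = 0.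
Proof.
move=> a0.
set S := \sum_x _; pose S' := \sum_(x : 'F_p) sinF (a * x).
have shift (g : 'F_p -> R) : \sum_x g (a * x) = \sum_x g (a * x + a).
  rewrite (reindex_inj (addIr (1 : 'F_p))) /=; apply: eq_bigr => x _.
  by rewrite mulrDr mulr1.
have e1 : S = S * cosF a - S' * sinF a.
  rewrite {1}/S shift /S /S' !mulr_suml -sumrB.
  by apply: eq_bigr => x _; rewrite cosFD.
have e2 : S' = S' * cosF a + S * sinF a.
  rewrite {1}/S' shift /S /S' !mulr_suml -big_split /=.
  by apply: eq_bigr => x _; rewrite sinFD.
have h := cosF2DsinF2 a.
have : S * (1 - cosF a) = 0.
  (* [e1'] and [e2'] say that the rotation fixes the vector (S, S'). *)
  have e1' : S * (1 - cosF a) + S' * sinF a = 0 by move: e1; lra.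
  have e2' : S' * (1 - cosF a) - S * sinF a = 0 by move: e2; lra.
  have : 2 * (S * (1 - cosF a)) = (S * (1 - cosF a) + S' * sinF a) * (1 - cosF a)
      - sinF a * (S' * (1 - cosF a) - S * sinF a) + S * (1 - (cosF a ^+ 2 + sinF a ^+ 2)).
    by ring.
  by rewrite e1' e2' h; lra.
move/eqP; rewrite mulf_eq0 subr_eq0 => /orP[/eqP //|].
by rewrite eq_sym (negbTE (cosF_neq1 a0)).
Qed.

Lemma sum_cosF0 : \sum_(x : 'F_p) cosF (0 * x) = p%:R.
Proof.
rewrite (eq_bigr (fun => 1)) => [|x _]; last by rewrite mul0r cosF0.
by rewrite sumr_const card_Fp.
Qed.

(** This is an equality; the upper bound is what turns probabilities of a value
into averages of expected cosines. *)
Lemma indicator_le_cosF (m : 'F_p) :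
  (m == 0)%:R <= p%:R^-1 * \sum_(x : 'F_p) cosF (x * m).
Proof.
under eq_bigr do rewrite mulrC.
have p0 : (p%:R : R) != 0 by rewrite pnatr_eq0 -lt0n prime_gt0.
have [->|m0] := eqVneq m 0; first by rewrite sum_cosF0 mulVf.
by rewrite sum_cosF // mulr0.
Qed.

End Characters.

(** * Level sets of the energy *)

Lemma sum_odd (R : comNzRingType) (K : nat) :
  \sum_(k < K) (2 * k%:R + 1) = K%:R ^+ 2 :> R.
Proof.
elim: K => [|K IH]; first by rewrite big_ord0 expr0n.
by rewrite big_ord_recr /= IH -natr1; ring.
Qed.

Lemma sqrt_ceil (n : nat) : (0 < n)%N -> exists2 K : nat, (0 < K)%N &
  (n <= K ^ 2)%N /\ (K ^ 2 <= 4 * n)%N.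
Proof.
move=> n0.
have ex : exists K, (n <= K ^ 2)%N by exists n; rewrite expnS expn1 leq_pmulr.
case: (ex_minnP ex) => K nK minK.
have K0 : (0 < K)%N by case: K nK {minK} => //; rewrite leqNgt n0.
exists K => //; split=> //.
case: K K0 nK minK => // K _ nK minK.
have : (K ^ 2 < n)%N by rewrite ltnNge; apply/negP => /minK; rewrite ltnn.
by nia.
Qed.

(** Layer-cake decomposition of [(1 + E) ^- 2] with thresholds
[n / (8 (k + 1) ^ 2)].  If [q] is the first index at which the threshold lies
below [E], the sum of odd numbers is at least [q ^ 2], which is comparable to
[n / E]; the term [64 / n ^ 2] takes care of [q = 0].  If there is no such
index, the sum is [K ^ 2] and the bound exceeds 1. *)
Lemma inv_sqr_le_layers (R : realFieldType) (n K : nat) (E : R) :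
  (0 < n)%N -> (0 < K)%N -> (K ^ 2 <= 4 * n)%N -> 0 <= E ->
  (1 + E) ^- 2 <= 64 / n%:R ^+ 2 + 128 / K%:R ^+ 2 *
    \sum_(k < K) (2 * k%:R + 1) * (E <= n%:R / (8 * k.+1%:R ^+ 2))%R%:R.
Proof.
move=> n0 K0 K2 E0.
have nR : (0 : R) < n%:R by rewrite ltr0n.
have KR : (0 : R) < K%:R by rewrite ltr0n.
have K2R : K%:R ^+ 2 <= 4 * n%:R :> R by rewrite -natrX -natrM ler_nat.
have EP : 0 < 1 + E by rewrite (lt_le_trans ltr01) // lerDl.
pose in_level k := E <= n%:R / (8 * k.+1%:R ^+ 2).
have term_ge0 k : 0 <= (2 * k%:R + 1) * (in_level k)%:R :> R.
  by rewrite mulr_ge0 // addr_ge0 // mulr_ge0.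
have sum_ge0 : 0 <= \sum_(k < K) (2 * k%:R + 1) * (in_level k)%:R :> R.
  by apply: sumr_ge0 => k _; exact: term_ge0.
have [/forallP allk|] := boolP [forall k : 'I_K, in_level k].
  rewrite (eq_bigr (fun k : 'I_K => 2 * k%:R + 1)) => [|k _]; last first.
    by have := allk k; rewrite /in_level => ->; rewrite mulr1.
  rewrite sum_odd mulfVK ?expf_neq0 ?gt_eqF //.
  have : (1 + E) ^- 2 <= 1 by rewrite invf_le1 ?exprn_gt0 // exprn_ege1 // lerDl.
  move/le_trans; apply; have : 0 <= 64 / n%:R ^+ 2 :> R by rewrite divr_ge0 ?exprn_ge0 ?ler0n.
  lra.
rewrite negb_forall => /existsP[k0 hk0].
(* [q] is the first level that [E] exceeds. *)
have ex : exists k, (k < K)%N && ~~ in_level k by exists k0; rewrite ltn_ord.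
case: (ex_minnP ex) => q /andP[qK nq] minq {k0 hk0 ex}.
rewrite /in_level -ltNge in nq.
case: q qK nq minq => [|q] qK nq minq.
  rewrite -[leLHS]addr0; apply: lerD; last first.
    by rewrite mulr_ge0 // divr_ge0 ?exprn_ge0 ?ler0n.
  rewrite expr1n mulr1 in nq.
  have -> : 64 / n%:R ^+ 2 = (n%:R / 8) ^- 2 :> R by field; rewrite gt_eqF.
  rewrite lef_pV2 ?posrE ?exprn_gt0 // ?divr_gt0 //.
  rewrite lerXn2r ?nnegrE ?divr_ge0 // ?ltW //.
  by apply: (lt_trans nq); rewrite ltrDr.
rewrite -[leLHS]add0r; apply: lerD; first by rewrite divr_ge0 ?exprn_ge0 ?ler0n.
have sumq : q.+1%:R ^+ 2 <= \sum_(k < K) (2 * k%:R + 1) * (in_level k)%:R :> R.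
  rewrite -(big_mkord xpredT (fun k => (2 * k%:R + 1) * (in_level k)%:R)).
  rewrite (big_cat_nat (n := q.+1)) //=; last exact: ltnW.
  rewrite -[leLHS]addr0; apply: lerD; last by apply: sumr_ge0 => k _; exact: term_ge0.
  rewrite -sum_odd -(big_mkord xpredT (fun k => (2 * k%:R + 1))).
  rewrite big_nat_cond [leRHS]big_nat_cond; apply: ler_sum => k; rewrite andbT => /andP[_ kq].
  suff -> : in_level k by rewrite mulr1.
  apply/negPn/negP => nk; have : (q.+1 <= k)%N by apply: minq; rewrite nk (ltn_trans kq).
  by rewrite leqNgt kq.
have qR : (1 : R) <= q.+1%:R by rewrite ler1n.
apply: (@le_trans _ _ (128 / K%:R ^+ 2 * q.+1%:R ^+ 2)); last first.
  by rewrite ler_wpM2l // divr_ge0 ?exprn_ge0 ?ler0n.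
apply: (@le_trans _ _ (1 + E)^-1).
  by rewrite lef_pV2 ?posrE ?exprn_gt0 // expr2 ler_peMl ?lerDl // ltW.
rewrite -[leLHS]mul1r ler_pdivrMr //.
have -> : 128 / K%:R ^+ 2 * q.+1%:R ^+ 2 * (1 + E)
    = 128 * q.+1%:R ^+ 2 * (1 + E) / K%:R ^+ 2 by ring.
rewrite ler_pdivlMr ?exprn_gt0 // mul1r.
move: nq; rewrite -natr1 ltr_pdivrMr; last by rewrite mulr_gt0 // exprn_gt0 // addr_gt0 // ltr0n.
set Q := q.+1%:R in qR *; move=> nq.
have : (Q + 1) ^+ 2 <= 4 * Q ^+ 2 by move: qR; nra.
move: nq K2R E0; nra.
Qed.

Section LevelSets.
Variables (R : realType) (p : nat).
Hypothesis p_prime : prime p.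
Variables (n : nat) (w : 'I_n -> 'F_p).

(** The function [G] of the introduction, for the residues [w j] of the
weights. *)
Definition energy (x : 'F_p) : R := \sum_j sinF R (x * w j) ^+ 2.

Definition level (t : R) : {set 'F_p} := [set x | energy x <= t]%SET.

Lemma energy_ge0 x : 0 <= energy x.
Proof. by apply: sumr_ge0 => j _; exact: sqr_ge0. Qed.

Lemma energy0 : energy 0 = 0.
Proof. by rewrite /energy big1 // => j _; rewrite mul0r sinF0 expr0n. Qed.

(** A squared form of the subadditivity of the square root of [energy]: with
[energy x <= k ^ 2 t] and [energy y <= t] it yields the bound [(k + 1) ^ 2 t]. *)
Lemma energyD (k : R) x y : 0 < k ->
  energy (x + y) <= (1 + k^-1) * energy x + (1 + k) * energy y.
Proof.
move=> k0; rewrite /energy !mulr_sumr -big_split /=; apply: ler_sum => j _.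
rewrite mulrDl sinFD //.
set a := _ * w j; set b := _ * w j.
have ha := cosF2DsinF2 R a; have hb := cosF2DsinF2 R b.
set ca := cosF R a in ha *; set cb := cosF R b in hb *.
set sa := sinF R a in ha *; set sb := sinF R b in hb *.
have : (sa * cb + ca * sb) ^+ 2
    <= (1 + k^-1) * (sa * cb) ^+ 2 + (1 + k) * (ca * sb) ^+ 2.
  rewrite -(ler_pM2l k0) -subr_ge0.
  have -> : k * ((1 + k^-1) * (sa * cb) ^+ 2 + (1 + k) * (ca * sb) ^+ 2)
      - k * (sa * cb + ca * sb) ^+ 2 = (sa * cb - k * (ca * sb)) ^+ 2.
    by field; rewrite gt_eqF.
  exact: sqr_ge0.
move=> /le_trans; apply.
rewrite !exprMn; apply: lerD; rewrite ler_wpM2l //.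
- by rewrite addr_ge0 // invr_ge0 ltW.
- by rewrite ler_piMr ?sqr_ge0 // -hb lerDl sqr_ge0.
- by rewrite addr_ge0 // ltW.
- by rewrite ler_piMl ?sqr_ge0 // -ha lerDl sqr_ge0.
Qed.

Lemma level_iter_sumset (t : R) k x :
  x \in iter k (sumset (level t)) (level t) -> energy x <= k.+1%:R ^+ 2 * t.
Proof.
elim: k x => [|k IH] x /=; first by rewrite inE expr1n mul1r.
move=> /finset.imset2P[y z]; rewrite inE => yt /IH zt ->.
have kR : (0 : R) < k.+1%:R by rewrite ltr0n.
rewrite addrC; apply: le_trans (energyD _ _ kR) _.
apply: (@le_trans _ _ ((1 + k.+1%:R^-1) * (k.+1%:R ^+ 2 * t) + (1 + k.+1%:R) * t)).
  by apply: lerD; rewrite ler_wpM2l // addr_ge0 // ?invr_ge0 ltW.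
rewrite le_eqVlt; apply/orP; left; apply/eqP; rewrite -[k.+2%:R]natr1; field.
by rewrite gt_eqF.
Qed.

Hypothesis n_gt0 : (0 < n)%N.
Hypothesis w_inj : injective w.
Hypothesis w_add : forall i j, w i + w j != 0.

Lemma two_neq0 : 2 != 0 :> 'F_p.
Proof.
have := w_add (Ordinal n_gt0) (Ordinal n_gt0).
by apply: contraNneq => two0; rewrite -mulr2n -mulr_natr two0 mulr0.
Qed.

Lemma sum_cosF2_energy x : \sum_j cosF R (2 * w j * x) = n%:R - 2 * energy x.
Proof.
have -> : n%:R = \sum_(j < n) (1 : R) by rewrite sumr_const card_ord.
rewrite /energy mulr_sumr -sumrB.
apply: eq_bigr => j _.
have -> : 2 * w j * x = x * w j + x * w j by ring.
have := cosF2DsinF2 R (x * w j); rewrite cosFD //; lra.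
Qed.

(** Parseval: the frequencies [2 * w j] are pairwise distinct up to sign, so the
off-diagonal products of cosines sum to 0, and each diagonal one contributes
[p / 2]. *)
Lemma sum_sqr_sum_cosF :
  \sum_(x : 'F_p) (\sum_j cosF R (2 * w j * x)) ^+ 2 = p%:R * n%:R / 2.
Proof.
have prodc (i j : 'I_n) x : cosF R (2 * w i * x) * cosF R (2 * w j * x) =
    (cosF R (2 * (w i + w j) * x) + cosF R (2 * (w i - w j) * x)) / 2.
  have -> : 2 * (w i + w j) * x = 2 * w i * x + 2 * w j * x by ring.
  have -> : 2 * (w i - w j) * x = 2 * w i * x + - (2 * w j * x) by ring.
  by rewrite !cosFD // cosFN // sinFN //; field.
under eq_bigr => x _.
  rewrite expr2 big_distrl /=.
  under eq_bigr => i _.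
    rewrite big_distrr /=.
    under eq_bigr do rewrite prodc.
    over.
  over.
rewrite exchange_big /=.
under eq_bigr => i _.
  rewrite exchange_big /= (bigD1 i) //= [X in _ + X]big1 => [|j ji].
    rewrite addr0 -mulr_suml big_split /= subrr mulr0 sum_cosF0 //.
    rewrite sum_cosF ?mulf_neq0 ?two_neq0 // add0r.
    over.
  rewrite -mulr_suml big_split /= !sum_cosF ?addr0 ?mul0r //.
    by rewrite mulf_neq0 ?two_neq0 // subr_eq0 (inj_eq w_inj) eq_sym.
  by rewrite mulf_neq0 ?two_neq0.
by rewrite sumr_const card_ord -mulr_natr; field.
Qed.

(** On this level set the sum of the cosines is at least [3 n / 4], so Chebyshev's
inequality applies to the second moment computed above. *)
Lemma card_level_base : 9 * n%:R * #|level (n%:R / 8)|%:R <= 8 * p%:R :> R.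
Proof.
have nR : (0 : R) < n%:R by rewrite ltr0n.
set L := level _.
have : \sum_(x in L) (3 / 4 * n%:R) ^+ 2 <= p%:R * n%:R / 2 :> R.
  rewrite -sum_sqr_sum_cosF [leRHS](bigID (mem L)) /=.
  rewrite -[leLHS]addr0; apply: lerD; last by apply: sumr_ge0 => x _; exact: sqr_ge0.
  apply: ler_sum => x; rewrite inE sum_cosF2_energy => xL.
  by rewrite lerXn2r ?nnegrE; move: xL nR; lra.
rewrite sumr_const -mulr_natr; set l := _%:R => h.
rewrite -(ler_pM2r nR); move: h; nra.
Qed.

(** The [k]-fold sumset of the level set lies in the base level set, which is too
small for the sumset to be all of [Z/p]; Cauchy-Davenport then makes the level set
at most [1 / k] of the base one, up to the error [k]. *)
Lemma card_level (k : nat) : (0 < k)%N ->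
  k%:R * #|level (n%:R / (8 * k%:R ^+ 2))|%:R <= p%:R / n%:R + k%:R :> R.
Proof.
case: k => // k _.
have nR : (0 : R) < n%:R by rewrite ltr0n.
have pR : (0 : R) < p%:R by rewrite ltr0n prime_gt0.
set t := _ / (8 * _); set L := level t.
have t0 : 0 <= t by rewrite divr_ge0 // mulr_ge0 // exprn_ge0.
have L0 : L != finset.set0.
  by apply/finset.set0Pn; exists 0; rewrite inE energy0.
have sub : (#|iter k (sumset L) L| <= #|level (n%:R / 8)|)%N.
  apply/subset_leq_card/fintype.subsetP => x /level_iter_sumset.
  rewrite inE /t; congr (_ <= _); field.
  by rewrite addrC natr1 pnatr_eq0.
have ltp : (#|level (n%:R / 8)| < p)%N.
  rewrite -(ltr_nat R); have := card_level_base.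
  have : (1 : R) <= n%:R by rewrite ler1n.
  have : (0 : R) <= #|level (n%:R / 8)|%:R by [].
  move: pR; nra.
have := leq_trans (card_iter_sumset p_prime k L0) sub.
rewrite geq_min leqNgt ltp /= => h.
have {h} : (k.+1 * #|L|.-1).+1%:R <= #|level (n%:R / 8)|%:R :> R by rewrite ler_nat.
have cL : (0 < #|L|)%N by rewrite card_gt0.
rewrite -natr1 natrM -subn1 natrB // => h1.
have h2 : #|level (n%:R / 8)|%:R <= p%:R / n%:R :> R.
  rewrite ler_pdivlMr //; have := card_level_base.
  by move: pR; nra.
move: h1 h2; lra.
Qed.

Lemma sum_inv_energy : (2 * n ^ 2 <= p)%N ->
  \sum_(x : 'F_p) (1 + energy x) ^- 2 <= 576 * p%:R / (n%:R * Num.sqrt n%:R).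
Proof.
move=> np; have [K K0 [nK K4]] := sqrt_ceil n_gt0.
have nR : (1 : R) <= n%:R by rewrite ler1n.
have n0 : (0 : R) < n%:R by rewrite ltr0n.
have KR : (0 : R) < K%:R by rewrite ltr0n.
have pR : (0 : R) < p%:R by rewrite ltr0n prime_gt0.
set r := Num.sqrt _.
have r2 : r ^+ 2 = n%:R by rewrite sqr_sqrtr.
have r0 : 0 < r by rewrite sqrtr_gt0.
have r1 : 1 <= r by rewrite -sqrtr1 ler_wsqrtr.
have rK : r <= K%:R.
  by rewrite -(@ler_pXn2r _ 2) ?nnegrE ?(ltW r0) // r2 -natrX ler_nat.
have nKp : n%:R * K%:R <= p%:R :> R.
  rewrite -natrM ler_nat; apply: leq_trans np.
  have : (K <= 2 * n)%N.
    by rewrite -(@leq_exp2r _ _ 2) // expnMn (leq_trans K4) // leq_mul2l /= expnS expn1 leq_pmulr.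
  by nia.
apply: (@le_trans _ _ (\sum_(x : 'F_p) (64 / n%:R ^+ 2 + 128 / K%:R ^+ 2 *
    \sum_(k < K) (2 * k%:R + 1) * (energy x <= n%:R / (8 * k.+1%:R ^+ 2))%R%:R))).
  by apply: ler_sum => x _; apply: inv_sqr_le_layers; rewrite ?energy_ge0.
rewrite big_split /= sumr_const card_Fp // -mulr_sumr exchange_big /=.
have layer (k : 'I_K) : \sum_(x : 'F_p) (2 * k%:R + 1) *
    (energy x <= n%:R / (8 * k.+1%:R ^+ 2))%R%:R <= 2 * (p%:R / n%:R + K%:R) :> R.
  rewrite -mulr_sumr -natr_sum.
  have -> : (\sum_(x : 'F_p) (energy x <= n%:R / (8 * k.+1%:R ^+ 2))%R
      = #|level (n%:R / (8 * k.+1%:R ^+ 2))|)%N.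
    rewrite -sum1_card [RHS]big_mkcond; apply: eq_bigr => x _.
    by rewrite inE; case: (_ <= _)%R.
  have h := card_level (ltn0Sn k).
  set L := #|_|%:R in h *.
  have L0 : 0 <= L by rewrite /L.
  have kK : k.+1%:R <= K%:R :> R by rewrite ler_nat ltn_ord.
  move: h kK L0; rewrite -natr1; nra.
have S_le : \sum_(k < K) \sum_(x : 'F_p) (2 * k%:R + 1) *
    (energy x <= n%:R / (8 * k.+1%:R ^+ 2))%R%:R <= 4 * K%:R * p%:R / n%:R :> R.
  apply: (@le_trans _ _ (\sum_(k < K) 2 * (p%:R / n%:R + K%:R))).
    by apply: ler_sum => k _; exact: layer.
  rewrite sumr_const card_ord -mulr_natr.
  have : K%:R <= p%:R / n%:R :> R by rewrite ler_pdivlMr // mulrC.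
  set u := p%:R / n%:R.
  have -> : 4 * K%:R * p%:R / n%:R = 4 * K%:R * u :> R by rewrite /u mulrA.
  by move: KR; nra.
apply: (@le_trans _ _ (64 * p%:R / (n%:R * r) + 512 * p%:R / (n%:R * r))); last first.
  by rewrite -!mulrDl -natrD.
apply: lerD.
  rewrite -[leLHS]mulr_natr mulrAC ler_wpM2l ?mulr_ge0 //.
  rewrite lef_pV2 ?posrE ?mulr_gt0 ?exprn_gt0 // expr2 ler_wpM2l ?(ltW n0) //.
  by rewrite -r2 expr2 ler_peMr // (ltW r0).
apply: (@le_trans _ _ (128 / K%:R ^+ 2 * (4 * K%:R * p%:R / n%:R))).
  by rewrite ler_wpM2l // divr_ge0 ?exprn_ge0 ?ler0n.
have -> : 128 / K%:R ^+ 2 * (4 * K%:R * p%:R / n%:R) = 512 * p%:R / (n%:R * K%:R) :> R.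
  by field; rewrite !gt_eqF.
apply: ler_wpM2l; first by rewrite mulr_ge0 ?ler0n.
by rewrite lef_pV2 ?posrE ?mulr_gt0 ?ler_wpM2l ?(ltW n0).
Qed.

End LevelSets.

(** * Variance and pointwise rotations *)

Section Variance.
Variables (R : realFieldType) (N : nat) (mu : 'I_N -> R).
Hypothesis mu_ge0 : forall a, 0 <= mu a.
Hypothesis mu_sum : \sum_a mu a = 1.

Definition mean (u : 'I_N -> R) : R := \sum_a mu a * u a.
Definition variance (u : 'I_N -> R) : R := mean (fun a => (u a - mean u) ^+ 2).

Lemma eq_mean u w : u =1 w -> mean u = mean w.
Proof. by move=> e; apply: eq_bigr => a _; rewrite e. Qed.

Lemma meanD u w : mean (fun a => u a + w a) = mean u + mean w.
Proof. by rewrite /mean -big_split; apply: eq_bigr => a _; rewrite mulrDr. Qed.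

Lemma meanZ k u : mean (fun a => k * u a) = k * mean u.
Proof. by rewrite /mean mulr_sumr; apply: eq_bigr => a _; rewrite mulrCA. Qed.

Lemma mean_cst k : mean (fun=> k) = k.
Proof. by rewrite /mean -mulr_suml mu_sum mul1r. Qed.

Lemma ler_mean u w : (forall a, u a <= w a) -> mean u <= mean w.
Proof. by move=> h; apply: ler_sum => a _; rewrite ler_wpM2l. Qed.

Lemma mean_ge0 u : (forall a, 0 <= u a) -> 0 <= mean u.
Proof. by move=> h; apply: sumr_ge0 => a _; rewrite mulr_ge0. Qed.

Lemma variance_ge0 u : 0 <= variance u.
Proof. by apply: mean_ge0 => a; exact: sqr_ge0. Qed.

Lemma mean_sqr u : mean (fun a => u a ^+ 2) = mean u ^+ 2 + variance u.
Proof.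
pose m := mean u.
have -> : variance u = mean (fun a => u a ^+ 2 + (- 2 * m * u a + m ^+ 2)).
  by apply: eq_mean => a; rewrite -/m; ring.
rewrite !meanD meanZ mean_cst -/m; ring.
Qed.

Lemma variance_le_mean_sqr u : variance u <= mean (fun a => u a ^+ 2).
Proof. by rewrite mean_sqr lerDr sqr_ge0. Qed.

Lemma variance_subC u k : variance (fun a => u a - k) = variance u.
Proof.
have e : mean (fun a => u a - k) = mean u - k by rewrite meanD mean_cst.
by apply: eq_mean => a; rewrite e; congr (_ ^+ 2); ring.
Qed.

Section Rotation.
Variables (c s : R) (f u w : 'I_N -> R).
Hypothesis cs1 : c ^+ 2 + s ^+ 2 = 1.
Hypothesis f_sqr : forall a, f a ^+ 2 = 1.
Hypothesis f_mean0 : mean f = 0.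

(** [rot1] and [rot2] are the two coordinates of the pair of functions after the
pair of values at each state [a] is rotated by the angle with cosine [c] and sine
[s * f a]. *)
Definition rot1 (y z : 'I_N -> R) a := c * y a + s * f a * z a.
Definition rot2 (y z : 'I_N -> R) a := c * z a - s * f a * y a.

Lemma rot_sqr y z a : rot1 y z a ^+ 2 + rot2 y z a ^+ 2 = y a ^+ 2 + z a ^+ 2.
Proof.
rewrite /rot1 /rot2.
transitivity ((c ^+ 2 + s ^+ 2 * f a ^+ 2) * (y a ^+ 2 + z a ^+ 2)); first by ring.
by rewrite f_sqr mulr1 cs1 mul1r.
Qed.

(** By [mean_sqr] both sides are second moments, and the rotation preserves the sum
of the two squares at each state. *)
Lemma rot_moment :
  (mean (rot1 u w) ^+ 2 + mean (rot2 u w) ^+ 2)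
    + (variance (rot1 u w) + variance (rot2 u w)) =
  (mean u ^+ 2 + mean w ^+ 2) + (variance u + variance w).
Proof.
rewrite addrACA -!mean_sqr addrACA -!mean_sqr -!meanD.
by apply: eq_mean => a; rewrite rot_sqr.
Qed.

(** The rotation creates variance: it sends the constant functions [mean u] and
[mean w] to functions with fluctuating parts [s * mean w * f] and
[- s * mean u * f], of second moment [s ^+ 2 * mean ^+ 2]; only the variance
already present, before or after, can hide them. *)
Lemma rot_variance_ge :
  s ^+ 2 * (mean u ^+ 2 + mean w ^+ 2) <=
  2 * (variance (rot1 u w) + variance (rot2 u w)) + 2 * (variance u + variance w).
Proof.
pose u0 a := u a - mean u; pose w0 a := w a - mean w.
have E1 : mean (rot1 u w) = c * mean u + mean (rot1 u0 w0).
  rewrite (@eq_mean (rot1 u w) (fun a => c * mean u + (s * mean w * f a + rot1 u0 w0 a))).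
    by rewrite !meanD mean_cst (meanZ _ f) f_mean0 mulr0 add0r.
  by move=> a; rewrite /rot1 /u0 /w0; ring.
have E2 : mean (rot2 u w) = c * mean w + mean (rot2 u0 w0).
  rewrite (@eq_mean (rot2 u w) (fun a => c * mean w + (- (s * mean u) * f a + rot2 u0 w0 a))).
    by rewrite !meanD mean_cst (meanZ _ f) f_mean0 mulr0 add0r.
  by move=> a; rewrite /rot2 /u0 /w0; ring.
have sqr_le (x y : R) : (x - y) ^+ 2 <= 2 * x ^+ 2 + 2 * y ^+ 2.
  rewrite -subr_ge0 (_ : _ - _ = (x + y) ^+ 2) ?sqr_ge0 //; ring.
have V1 : (s * mean w) ^+ 2 <= 2 * variance (rot1 u w) + 2 * variance (rot1 u0 w0).
  rewrite [leRHS](_ : _ = mean (fun a => 2 * (rot1 u w a - mean (rot1 u w)) ^+ 2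
      + 2 * (rot1 u0 w0 a - mean (rot1 u0 w0)) ^+ 2)); last by rewrite meanD !meanZ.
  rewrite -[leLHS]mean_cst; apply: ler_mean => a.
  have -> : (s * mean w) ^+ 2 = ((rot1 u w a - mean (rot1 u w)) - (rot1 u0 w0 a - mean (rot1 u0 w0))) ^+ 2.
    rewrite E1 (_ : _ - _ - _ = s * mean w * f a); first by rewrite [RHS]exprMn f_sqr mulr1.
    by rewrite /rot1 /u0 /w0; ring.
  exact: sqr_le.
have V2 : (s * mean u) ^+ 2 <= 2 * variance (rot2 u w) + 2 * variance (rot2 u0 w0).
  rewrite [leRHS](_ : _ = mean (fun a => 2 * (rot2 u w a - mean (rot2 u w)) ^+ 2
      + 2 * (rot2 u0 w0 a - mean (rot2 u0 w0)) ^+ 2)); last by rewrite meanD !meanZ.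
  rewrite -[leLHS]mean_cst; apply: ler_mean => a.
  have -> : (s * mean u) ^+ 2 = ((rot2 u w a - mean (rot2 u w)) - (rot2 u0 w0 a - mean (rot2 u0 w0))) ^+ 2.
    rewrite E2 (_ : _ - _ - _ = - (s * mean u) * f a); first by rewrite [RHS]exprMn f_sqr mulr1 sqrrN.
    by rewrite /rot2 /u0 /w0; ring.
  exact: sqr_le.
have V3 : variance (rot1 u0 w0) + variance (rot2 u0 w0) <= variance u + variance w.
  apply: (le_trans (lerD (variance_le_mean_sqr _) (variance_le_mean_sqr _))).
  by rewrite -!meanD; apply: ler_mean => a; rewrite rot_sqr.
rewrite mulrDr -!exprMn; lra.
Qed.

End Rotation.

(** The quadratic inequality behind [potential_step]: [x] and [V] stand for the
squared means and variances of a pair, [V1] for the variances after the transition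
matrix, [x'] and [V'] for the values after the rotation.  With [r = lam * V], the
loss is at least [(1 - lam) * (V' + r)], and [V' + r] is at least a third of
[s2 * (x + r)]. *)
Lemma contraction_arith (lam s2 x V V1 x' V' : R) :
  0 <= lam -> lam <= 1 -> 0 <= s2 -> s2 <= 1 -> 0 <= V -> 0 <= V' ->
  V1 <= lam ^+ 2 * V -> x' + V' = x + V1 -> s2 * x <= 2 * V' + 2 * V1 ->
  x' + lam * V' <= (1 - (1 - lam) * s2 / 3) * (x + lam * V).
Proof.
move=> l0 l1 s0 s1 V0 V'0; rewrite expr2 -mulrA; set r := lam * V.
have r0 : 0 <= r by rewrite mulr_ge0.
move=> hV1 hx hs.
have lr : lam * r <= r by rewrite ler_piMl.
have key : s2 * (x + r) <= 3 * (V' + r).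
  have : s2 * r <= r by rewrite ler_piMl.
  move: lr hV1 hs r0; lra.
have : (1 - lam) * (s2 * (x + r)) <= (1 - lam) * (3 * (V' + r)).
  by rewrite ler_wpM2l // subr_ge0.
move: hV1 hx; lra.
Qed.

(** The squared norm of the pair after applying the operator that fixes constants
and multiplies mean-zero functions by the square root of [lam]. *)
Definition potential (lam : R) (u w : 'I_N -> R) : R :=
  (mean u ^+ 2 + mean w ^+ 2) + lam * (variance u + variance w).

(** One step of the backward recursion: [u1] and [w1] are the images of [u] and
[w] under the transition matrix, which are then rotated. *)
Lemma potential_step (lam c s : R) (f u w u1 w1 : 'I_N -> R) :
  0 <= lam -> lam <= 1 -> c ^+ 2 + s ^+ 2 = 1 ->
  (forall a, f a ^+ 2 = 1) -> mean f = 0 ->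
  mean u1 = mean u -> mean w1 = mean w ->
  variance u1 <= lam ^+ 2 * variance u -> variance w1 <= lam ^+ 2 * variance w ->
  potential lam (rot1 c s f u1 w1) (rot2 c s f u1 w1) <=
  (1 - (1 - lam) * s ^+ 2 / 3) * potential lam u w.
Proof.
move=> l0 l1 cs f2 f0 mu1 mw1 vu1 vw1.
apply: (@contraction_arith _ _ _ _ (variance u1 + variance w1)) => //.
- exact: sqr_ge0.
- by rewrite -cs lerDr sqr_ge0.
- by rewrite addr_ge0 ?variance_ge0.
- by rewrite addr_ge0 ?variance_ge0.
- by rewrite mulrDr lerD.
- by rewrite rot_moment // mu1 mw1.
- by have := rot_variance_ge u1 w1 cs f2 f0; rewrite mu1 mw1.
Qed.

End Variance.

(** * The transition operator and its spectral gap *)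

Section Spectral.
Variables (R : realType) (N : nat) (mu : 'I_N -> R) (A : 'M[R]_N).
Hypothesis mu_prob : prob_vector mu.
Hypothesis A_stoch : stochastic A.
Hypothesis A_rev : reversible A mu.

Let mu_ge0 := mu_prob.1.
Let mu_sum := mu_prob.2.

Definition transition (u : 'I_N -> R) a : R := \sum_b A a b * u b.

(** Reversibility makes [mu] stationary. *)
Lemma mean_transition u : mean mu (transition u) = mean mu u.
Proof.
rewrite /mean /transition.
under eq_bigr do rewrite mulr_sumr.
rewrite exchange_big /=; apply: eq_bigr => b _.
under eq_bigr do rewrite mulrA A_rev.
by rewrite -mulr_suml -mulr_sumr A_stoch.2 mulr1.
Qed.

Lemma transition_subC u k a : transition (fun b => u b - k) a = transition u a - k.
Proof.
rewrite /transition -[in RHS](mul1r k) -(A_stoch.2 a) mulr_suml -sumrB.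
by apply: eq_bigr => b _; rewrite mulrBr.
Qed.

(** Jensen's inequality, from the nonnegativity of the conditional variance. *)
Lemma transition_sqr_le u a : transition u a ^+ 2 <= transition (fun b => u b ^+ 2) a.
Proof.
set m := transition u a.
have : 0 <= transition (fun b => (u b - m) ^+ 2) a.
  by apply: sumr_ge0 => b _; rewrite mulr_ge0 ?sqr_ge0 // A_stoch.1.
have -> : transition (fun b => (u b - m) ^+ 2) a =
   transition (fun b => u b ^+ 2) a + (- 2 * m * m + m ^+ 2).
  transitivity (\sum_b (A a b * u b ^+ 2 + (- 2 * m * (A a b * u b) + m ^+ 2 * A a b))).
    by apply: eq_bigr => b _; ring.
  by rewrite !big_split /= -!mulr_sumr A_stoch.2 mulr1.
lra.
Qed.

Lemma variance_transition_le u : variance mu (transition u) <= variance mu u.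
Proof.
rewrite /variance mean_transition -[leRHS]mean_transition.
apply: ler_mean => // a; apply: le_trans (transition_sqr_le _ _).
by rewrite transition_subC.
Qed.

(** Subtracting the averaging operator removes the mean, which the transition
matrix preserves. *)
Lemma L2norm_centered (v : 'cV[R]_N) :
  L2norm mu ((A - averaging mu) *m v) = Num.sqrt (variance mu (transition (v^~ 0))).
Proof.
rewrite /L2norm /variance mean_transition {1}/mean; congr Num.sqrt.
apply: eq_bigr => a _; rewrite mulrC real_normK ?num_real //; congr (_ * _ ^+ 2).
rewrite mxE /transition /mean -sumrB; apply: eq_bigr => b _.
by rewrite !mxE mulrBl.
Qed.

Lemma L2normE (v : 'cV[R]_N) :
  L2norm mu v = Num.sqrt (mean mu (fun a => v a 0 ^+ 2)).
Proof.
rewrite /L2norm; congr Num.sqrt; apply: eq_bigr => a _.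
by rewrite mulrC real_normK ?num_real.
Qed.

Lemma L2norm_contract (v : 'cV[R]_N) :
  L2norm mu ((A - averaging mu) *m v) <= L2norm mu v.
Proof.
rewrite L2norm_centered L2normE ler_wsqrtr //.
apply: le_trans (variance_transition_le _) _.
exact: variance_le_mean_sqr.
Qed.

Let lambda := L2opnorm mu (A - averaging mu).

(** [L2norm_contract] bounds the set whose supremum is [lambda], so that this
supremum is an upper bound. *)
Lemma opnorm_ub (v : 'cV[R]_N) : L2norm mu v = 1 ->
  L2norm mu ((A - averaging mu) *m v) <= lambda.
Proof.
move=> v1; apply: ub_le_sup; last by exists v.
by exists 1 => _ [w w1 <-]; rewrite -w1 L2norm_contract.
Qed.

Lemma L2norm_cst1 : L2norm mu (\col__ 1) = 1.
Proof.
rewrite L2normE (@eq_mean _ _ _ _ (fun=> 1)) ?mean_cst ?sqrtr1 // => a.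
by rewrite mxE expr1n.
Qed.

Lemma opnorm_ge0 : 0 <= lambda.
Proof. by apply: le_trans (opnorm_ub L2norm_cst1); exact: sqrtr_ge0. Qed.

Lemma opnorm_le1 : lambda <= 1.
Proof.
apply: ge_sup; first by exists (L2norm mu ((A - averaging mu) *m \col__ 1)), (\col__ 1) => //=; exact: L2norm_cst1.
by move=> _ [w w1 <-]; rewrite -w1 L2norm_contract.
Qed.

(** By homogeneity from unit vectors; a vector of seminorm 0, which may be nonzero
where [mu] vanishes, is covered by [L2norm_contract]. *)
Lemma opnorm_bound (v : 'cV[R]_N) :
  L2norm mu ((A - averaging mu) *m v) <= lambda * L2norm mu v.
Proof.
have nZ (k : R) (w : 'cV[R]_N) : 0 <= k -> L2norm mu (k *: w) = k * L2norm mu w.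
  move=> k0; rewrite !L2normE (@eq_mean _ _ _ _ (fun a => k ^+ 2 * w a 0 ^+ 2)).
    by rewrite meanZ sqrtrM ?sqr_ge0 // sqrtr_sqr ger0_norm.
  by move=> a; rewrite mxE exprMn.
have [v0|v0] := eqVneq (L2norm mu v) 0.
  by rewrite v0 mulr0 -v0 L2norm_contract.
have vP : 0 < L2norm mu v by rewrite lt_def v0 sqrtr_ge0.
have := @opnorm_ub ((L2norm mu v)^-1 *: v).
rewrite -scalemxAr !nZ ?invr_ge0 ?sqrtr_ge0 // mulVf // => /(_ erefl).
by rewrite mulrC ler_pdivrMr.
Qed.

(** The operator bound applied to the centered function [u - mean u]. *)
Lemma variance_transition u :
  variance mu (transition u) <= lambda ^+ 2 * variance mu u.
Proof.
pose v : 'cV[R]_N := \col_a (u a - mean mu u).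
have := opnorm_bound v; rewrite L2norm_centered L2normE.
have -> : mean mu (fun a => v a 0 ^+ 2) = variance mu u.
  by apply: eq_mean => a; rewrite mxE.
have -> : variance mu (transition (v^~ 0)) = variance mu (transition u).
  rewrite -(variance_subC mu_sum (transition u) (mean mu u)).
  have e a : transition (v^~ 0) a = transition u a - mean mu u.
    by rewrite -transition_subC; apply: eq_bigr => b _; rewrite mxE.
  by rewrite /variance (eq_mean mu e); apply: eq_mean => a; rewrite e.
move=> h.
rewrite -(sqr_sqrtr (variance_ge0 mu_ge0 (transition u))).
rewrite -(sqr_sqrtr (variance_ge0 mu_ge0 u)) -exprMn.
by rewrite lerXn2r ?nnegrE ?mulr_ge0 ?sqrtr_ge0 ?opnorm_ge0.
Qed.

End Spectral.

(** * The backward recursion *)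

Section Backward.
Variables (R : realType) (N : nat) (A : 'M[R]_N).
Variable g : nat -> 'I_N -> int.

(** [backward zeta k i a x] is the expectation of [zeta (x - Z)] given that the
chain is at [a] at time [i], where [Z] is the sum of [g j] at the state of time [j]
over [i <= j < i + k].  There is one transition for each summand, so the recursion
ends one step after the last summand; this gives all its steps the same form. *)
Fixpoint backward (zeta : int -> R) (k i : nat) (a : 'I_N) (x : int) : R :=
  if k is k'.+1
  then transition A (fun b => backward zeta k' i.+1 b (x - g i a)) a
  else zeta x.

(** [backward] is monotone and linear in [zeta], so the character expansion of an
indicator carries over to it. *)
Lemma ler_backward_sum (I : finType) (kappa : R) (zeta : int -> R)
    (zetas : I -> int -> R) k i a x :
  (forall a b, 0 <= A a b) ->
  (forall y, zeta y <= kappa * \sum_t zetas t y) ->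
  backward zeta k i a x <= kappa * \sum_t backward (zetas t) k i a x.
Proof.
move=> A0 le; elim: k i a x => [|k IH] i a x /=; first exact: le.
rewrite /transition exchange_big /= mulr_sumr; apply: ler_sum => b _.
by rewrite -mulr_sumr mulrCA ler_wpM2l.
Qed.

Section Character.
Variables (p : nat).
Hypothesis p_prime : prime p.
Variable theta : 'F_p.

Definition backward_cos := backward (fun x => cosF R (theta * x%:~R)).
Definition backward_sin := backward (fun x => sinF R (theta * x%:~R)).

(** The addition formulas, averaged over the future: shifting the argument rotates
the pair (cosine, sine). *)
Lemma backward_shift k i a x m :
  backward_cos k i a (x - m) = cosF R (theta * m%:~R) * backward_cos k i a x
     + sinF R (theta * m%:~R) * backward_sin k i a x /\
  backward_sin k i a (x - m) = cosF R (theta * m%:~R) * backward_sin k i a x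
     - sinF R (theta * m%:~R) * backward_cos k i a x.
Proof.
elim: k i a x => [|k IH] i a x.
  rewrite /backward_cos /backward_sin /= intrB mulrBr.
  by rewrite cosFD // sinFD // cosFN // sinFN //; split; ring.
rewrite /backward_cos /backward_sin /= /transition !mulr_sumr -big_split -sumrB /=.
split; apply: eq_bigr => b _.
  rewrite addrAC -/(backward_cos _ _ _ _) -/(backward_cos _ _ _ _) -/(backward_sin _ _ _ _).
  by rewrite (IH _ _ _).1; ring.
rewrite addrAC -/(backward_cos _ _ _ _) -/(backward_sin _ _ _ _) -/(backward_sin _ _ _ _).
by rewrite (IH _ _ _).2; ring.
Qed.

End Character.

Variable mu : 'I_N -> R.
Hypothesis mu_prob : prob_vector mu.
Hypothesis A_stoch : stochastic A.
Hypothesis A_rev : reversible A mu.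

Let lambda := L2opnorm mu (A - averaging mu).

Variables (p : nat) (n : nat) (s : nat -> 'I_N -> int) (v : nat -> int).
Hypothesis p_prime : prime p.
Hypothesis gE : forall i a, (i < n)%N -> g i a = s i a * v i.
Hypothesis s_sign : forall i a, (i < n)%N -> s i a = -1 \/ s i a = 1.
Hypothesis s_mean : forall i, (i < n)%N -> mean mu (fun a => (s i a)%:~R) = 0.

(** Each step of the recursion is a transition followed by a rotation whose cosine
does not depend on the state, since [s i a] is a sign, and whose sine is a
multiple of the mean-zero function [s i]; [potential_step] applies to it.  The pair
starts as a constant unit vector, of potential 1. *)
Lemma potential_backward theta x k i : (i + k)%N = n ->
  potential mu lambda (fun a => backward_cos theta k i a x)
                      (fun a => backward_sin theta k i a x) <=
  \prod_(i <= j < n) (1 - (1 - lambda) * sinF R (theta * (v j)%:~R : 'F_p) ^+ 2 / 3).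
Proof.
have l0 := opnorm_ge0 mu_prob A_stoch A_rev.
have l1 := opnorm_le1 mu_prob A_stoch A_rev.
have [mu0 mu1] := mu_prob.
elim: k i => [|k IH] i ikn.
  rewrite addn0 in ikn; rewrite ikn big_geq // /backward_cos /backward_sin /=.
  rewrite /potential /variance !(mean_cst mu1) !subrr expr0n /=.
  by rewrite addr0 mulr0 addr0 cosF2DsinF2.
have iltn : (i < n)%N by rewrite -ikn addnS ltnS leq_addr.
rewrite big_ltn //.
set c := cosF R (theta * (v i)%:~R); set sn := sinF R (theta * (v i)%:~R).
pose f a : R := (s i a)%:~R.
pose u a := backward_cos theta k i.+1 a x; pose w a := backward_sin theta k i.+1 a x.
have cs : c ^+ 2 + sn ^+ 2 = 1 by exact: cosF2DsinF2.
have charg a : cosF R (theta * (g i a)%:~R) = c /\ sinF R (theta * (g i a)%:~R) = sn * f a.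
  rewrite gE // /f; have [->|->] := s_sign a iltn.
    by rewrite mulN1r rmorphN /= mulrN cosFN // sinFN // rmorphN /= mulrN mulr1.
  by rewrite mul1r mulr1.
rewrite (_ : potential _ _ _ _ = potential mu lambda (rot1 c sn f (transition A u) (transition A w))
    (rot2 c sn f (transition A u) (transition A w))); last first.
  congr (potential _ _ _ _); apply/funext => a.
    rewrite /rot1 /backward_cos /= /transition !mulr_sumr -big_split.
    apply: eq_bigr => b _ /=; rewrite -/(backward_cos _ _ _ _) (backward_shift p_prime theta _ _ _ _ _).1.
    by case: (charg a) => -> ->; rewrite /u /w; ring.
  rewrite /rot2 /backward_sin /= /transition !mulr_sumr -sumrB.
  apply: eq_bigr => b _ /=; rewrite -/(backward_sin _ _ _ _) (backward_shift p_prime theta _ _ _ _ _).2.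
  by case: (charg a) => -> ->; rewrite /u /w; ring.
have f_sqr a : f a ^+ 2 = 1.
  by rewrite /f; have [->|->] := s_sign a iltn; rewrite ?rmorphN ?sqrrN expr1n.
apply: le_trans (potential_step mu0 mu1 l0 l1 cs f_sqr (s_mean iltn)
   (mean_transition A_stoch A_rev u) (mean_transition A_stoch A_rev w)
   (variance_transition mu_prob A_stoch A_rev u) (variance_transition mu_prob A_stoch A_rev w)) _.
rewrite ler_wpM2l //.
  have : sn ^+ 2 <= 1 by rewrite -cs lerDr sqr_ge0.
  have := sqr_ge0 sn; rewrite -/lambda in l0 l1 *; nra.
by apply: IH; rewrite addSn -ikn addnS.
Qed.

(** The product is at most [expR (- (4 * z))] with
[z = (1 - lambda) * energy / 12], and [expR z >= 1 + z] turns the square root of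
this into [(1 + z) ^- 2]. *)
Lemma mean_backward_cos theta x : lambda < 1 ->
  mean mu (fun a => backward_cos theta n 0 a x) <=
  144 / (1 - lambda) ^+ 2 *
    (1 + energy R (fun j : 'I_n => (v j)%:~R) (theta : 'F_p)) ^- 2.
Proof.
move=> lt1.
have l0 := opnorm_ge0 mu_prob A_stoch A_rev.
have [mu0 mu1] := mu_prob.
set m := mean _ _; set G := energy _ _ _.
have G0 : 0 <= G by exact: energy_ge0.
have gap : 0 < 1 - lambda by rewrite subr_gt0.
have gap1 : 1 - lambda <= 1 by rewrite gerBl.
pose z := (1 - lambda) * G / 12.
have z0 : 0 <= z by rewrite divr_ge0 // mulr_ge0 // ltW.
have m2 : m ^+ 2 <= expR (- (4 * z)).
  apply: (@le_trans _ _ (potential mu lambda (fun a => backward_cos theta n 0 a x)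
                      (fun a => backward_sin theta n 0 a x))).
    rewrite /potential -/m -addrA lerDl addr_ge0 ?sqr_ge0 // mulr_ge0 //.
    by rewrite addr_ge0 // variance_ge0.
  apply: (le_trans (potential_backward theta x (add0n n))).
  rewrite big_mkord.
  have -> : - (4 * z) = \sum_(j < n) - ((1 - lambda) * sinF R (theta * (v j)%:~R) ^+ 2 / 3).
    rewrite sumrN -mulr_suml -mulr_sumr -/(energy R (fun j : 'I_n => (v j)%:~R) theta) -/G /z.
    by congr (- _); field.
  rewrite expR_sum; apply: ler_prod => j _.
  rewrite expR_ge1Dx andbT.
  have := cosF2DsinF2 R (theta * (v j)%:~R : 'F_p).
  have := sqr_ge0 (cosF R (theta * (v j)%:~R : 'F_p)).
  set c2 := _ ^+ 2; set s2 := _ ^+ 2 => c20 cs.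
  have s20 : 0 <= s2 by exact: sqr_ge0.
  by nra.
have z1 : 0 < 1 + z by rewrite (lt_le_trans ltr01) // lerDl.
have m1 : m <= (1 + z) ^- 2.
  apply: (le_trans (ler_norm m)).
  rewrite -sqrtr_sqr -[leRHS]gtr0_norm ?invr_gt0 ?exprn_gt0 // -[leRHS]sqrtr_sqr.
  rewrite ler_wsqrtr // (le_trans m2) // expRN exprVn -exprM.
  rewrite lef_pV2 ?posrE ?expR_gt0 ?exprn_gt0 //.
  rewrite expRM_natl lerXn2r ?nnegrE ?expR_ge0 ?(ltW z1) //.
  exact: expR_ge1Dx.
have G1 : 0 < 1 + G by rewrite (lt_le_trans ltr01) // lerDl.
apply: (le_trans m1).
have -> : 144 / (1 - lambda) ^+ 2 * (1 + G) ^- 2 = ((1 - lambda) * (1 + G) / 12) ^- 2.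
  by field; rewrite !gt_eqF.
rewrite lef_pV2 ?posrE ?exprn_gt0 ?divr_gt0 ?mulr_gt0 //.
rewrite lerXn2r ?nnegrE ?(ltW z1) ?divr_ge0 ?mulr_ge0 ?(ltW gap) ?(ltW G1) //.
rewrite /z; move: gap1; lra.
Qed.

End Backward.

(** * The law of the path *)

Section PathLaw.
Variables (R : realType) (d : measure_display) (T : measurableType d).
Variables (P : probability T R) (N : nat).

Lemma probability_partition (X : T -> 'I_N) (B : set T) :
  discrete_rv X -> measurable B ->
  P B = \sum_a P (B `&` [set t | X t = a]).
Proof.
move=> mX mB.
rewrite -(@measure_bigsetU_ord _ _ _ P N xpredT (fun a => B `&` [set t | X t = a])).
- congr (P _); apply/seteqP; split => [t Bt|t].
    by rewrite -bigcup_seq; exists (X t) => //=; rewrite mem_index_enum.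
  by rewrite -bigcup_seq => -[a _ []].
- by move=> a; apply: measurableI.
- by apply/trivIsetP => a b _ _ ab; apply/seteqP; split=> // t [[_ Xa] [_ Xb]]; move: ab; rewrite -Xa -Xb eqxx.
Qed.

Lemma measurable_cst_set (Q : Prop) : measurable [set _ : T | Q].
Proof.
have [q|nq] := pselect Q.
  by rewrite (_ : [set _ | _] = setT) //; apply/seteqP; split.
by rewrite (_ : [set _ | _] = set0) //; apply/seteqP; split.
Qed.

Lemma measurable_finite_union (X : T -> 'I_N) (B : 'I_N -> set T) :
  discrete_rv X -> (forall a, measurable (B a)) ->
  measurable [set t | B (X t) t].
Proof.
move=> mX mB.
rewrite (_ : [set _ | _] = \bigcup_(a in [set: 'I_N]) ([set t | X t = a] `&` B a)).
  by apply: fin_bigcup_measurable => // a _; apply: measurableI.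
by apply/seteqP; split=> [t Bt|t [a _ [<-]] //]; exists (X t).
Qed.

Lemma expectation_discrete (X : T -> 'I_N) (h : 'I_N -> R) :
  discrete_rv X ->
  ('E_P[fun t => h (X t)] = \sum_a (h a)%:E * P [set t | X t = a])%E.
Proof.
move=> mX; rewrite unlock.
have mh : measurable_fun [set: T] (fun t => h (X t)).
  move=> _ B _; rewrite setTI.
  by apply: (@measurable_finite_union X (fun a => [set _ | B (h a)])) => // a; exact: measurable_cst_set.
have cover : \big[setU/set0]_(a <- index_enum 'I_N) [set t | X t = a] = [set: T].
  apply/seteqP; split=> // t _; rewrite -bigcup_seq; exists (X t) => //=.
  by rewrite mem_index_enum.
rewrite -cover integral_bigsetU_EFin ?index_enum_uniq //.
- apply: eq_bigr => a _; rewrite -integral_cst //.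
  by apply: eq_integral => t; rewrite inE /= => ->.
- by apply/trivIsetP => a b _ _ ab; apply/seteqP; split=> // t [Xa Xb]; move: ab; rewrite -Xa -Xb eqxx.
- by rewrite cover; apply/measurable_realfun.measurable_EFinP.
Qed.

Variables (Y : nat -> T -> 'I_N) (A : 'M[R]_N) (mu : 'I_N -> R).
Hypothesis chain : stationary_reversible_chain P Y A mu.

Definition cylinder (i : nat) (a : nat -> 'I_N) : set T :=
  [set t | forall j, (j <= i)%N -> Y j t = a j].

Lemma measurable_cylinder i a : measurable (cylinder i a).
Proof.
elim: i => [|i IH].
  rewrite (_ : cylinder _ _ = [set t | Y 0 t = a 0%N]); first exact: src_rv chain _ _.
  by apply/seteqP; split => [t h|t Y0 j]; [exact: h|rewrite leqn0 => /eqP ->].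
rewrite (_ : cylinder _ _ = cylinder i a `&` [set t | Y i.+1 t = a i.+1]).
  by apply: measurableI => //; exact: src_rv chain _ _.
apply/seteqP; split => [t c|t [c Yi] j].
  by split=> [j ji|]; apply: c => //; exact: leqW.
by rewrite leq_eqVlt => /orP[/eqP -> //|]; rewrite ltnS; exact: c.
Qed.

Lemma cylinderS i a b :
  cylinder i a `&` [set t | Y i.+1 t = b] =
  cylinder i.+1 (fun j => if j == i.+1 then b else a j).
Proof.
apply/seteqP; split => [t [c Yi] j|t c].
  rewrite leq_eqVlt => /orP[/eqP -> |]; first by rewrite eqxx.
  by rewrite ltnS => ji; rewrite ltn_eqF ?ltnS //; exact: c.
split=> [j ji|]; last by have /= := c i.+1 (leqnn _); rewrite eqxx.
by have := c j (leqW ji); rewrite ltn_eqF ?ltnS.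
Qed.

(** The Markov property in product form; on a null past both sides are 0. *)
Lemma prob_cylinderS i a b :
  P (cylinder i a `&` [set t | Y i.+1 t = b]) = (P (cylinder i a) * (A (a i) b)%:E)%E.
Proof.
have mc := measurable_cylinder i a.
have mb := src_rv chain i.+1 b.
have [P0|P0] := eqVneq (P (cylinder i a)) 0%E.
  rewrite P0 mul0e; apply/eqP; rewrite eq_le measure_ge0 andbT -P0.
  by apply: le_measure; rewrite ?inE //; apply: measurableI.
have := src_markov chain b P0; rewrite /cond_prob setIC => h.
rewrite -h -/(cylinder i a).
rewrite -(fineK (fin_num_measure P _ mc)) in P0 *.
rewrite -(fineK (fin_num_measure P _ (measurableI _ _ mc mb))).
rewrite inver.
have P0' : fine (P (cylinder i a)) != 0 by move: P0; rewrite eqe.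
by rewrite (negbTE P0') -!EFinM mulrCA mulfV // mulr1.
Qed.

Variable g : nat -> 'I_N -> int.

Definition tail_event (k i : nat) (x : int) : set T :=
  [set t | \sum_(i <= j < i + k) g j (Y j t) = x].

Lemma tail_eventS k i x t :
  tail_event k.+1 i x t <-> tail_event k i.+1 (x - g i (Y i t)) t.
Proof.
rewrite /tail_event /= big_ltn ?addnS ?ltnS ?leq_addr // addSn.
by split=> [<-|->]; rewrite addrC ?addKr ?subrK.
Qed.

Lemma measurable_tail_event k i x : measurable (tail_event k i x).
Proof.
elim: k i x => [|k IH] i x.
  rewrite (_ : tail_event _ _ _ = [set _ | 0 = x]); first exact: measurable_cst_set.
  by apply/seteqP; split=> t; rewrite /tail_event /= addn0 big_geq.
rewrite (_ : tail_event _ _ _ = [set t | tail_event k i.+1 (x - g i (Y i t)) t]).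
  apply: (@measurable_finite_union (Y i) (fun a => tail_event k i.+1 (x - g i a))) => //.
  exact: src_rv chain _.
by apply/seteqP; split=> t /tail_eventS.
Qed.

(** Conditionally on the past up to time [i], the law of the future sum is given by
the backward recursion for the indicator of 0. *)
Lemma prob_cylinder_tail k i a x :
  P (cylinder i a `&` tail_event k i x) =
  (P (cylinder i a) * (backward A g (fun y => (y == 0)%:R) k i (a i) x)%:E)%E.
Proof.
elim: k i a x => [|k IH] i a x.
  rewrite /tail_event addn0 /= eq_sym.
  have [->|x0] := eqVneq x 0.
    rewrite mule1 (_ : _ `&` _ = cylinder i a) //.
    by apply/seteqP; split=> t; [case|move=> c; split=> //=; rewrite big_geq].
  rewrite mule0 (_ : _ `&` _ = set0) ?measure0 //.
  apply/seteqP; split=> // t [_] /=; rewrite big_geq // => /esym/eqP; by rewrite (negbTE x0).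
have mc := measurable_cylinder i a.
rewrite (probability_partition (src_rv chain i.+1)); last first.
  by apply: measurableI => //; exact: measurable_tail_event.
rewrite /= /transition -sumEFin ge0_sume_distrr.
  apply: eq_bigr => b _.
  have -> : cylinder i a `&` tail_event k.+1 i x `&` [set t | Y i.+1 t = b] =
     cylinder i.+1 (fun j => if j == i.+1 then b else a j) `&` tail_event k i.+1 (x - g i (a i)).
    rewrite -cylinderS; apply/seteqP; split=> t.
      move=> [[c /tail_eventS h] Yb]; split=> //.
      by rewrite -(c i).
    move=> [[c Yb] h]; split=> //; split=> //; apply/tail_eventS.
    by rewrite (c i).
  by rewrite IH eqxx -cylinderS prob_cylinderS EFinM muleA.
move=> b _; rewrite lee_fin mulr_ge0 //; first exact: (src_stochastic chain).1.
elim: (k) (i.+1) b (x - g i (a i)) => [|k' IH'] i' a' x' /=; first by case: (_ == _).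
by apply: sumr_ge0 => b' _; rewrite mulr_ge0 // (src_stochastic chain).1.
Qed.

Lemma prob_tail_event k x :
  P (tail_event k 0 x) =
  (mean mu (fun a => backward A g (fun y => (y == 0)%:R) k 0 a x))%:E.
Proof.
rewrite (probability_partition (src_rv chain 0)); last exact: measurable_tail_event.
rewrite /mean -sumEFin; apply: eq_bigr => a _.
rewrite setIC EFinM -(src_initial chain).
have -> : [set t | Y 0 t = a] = cylinder 0 (fun=> a).
  by apply/seteqP; split => [t Y0 j|t h]; [rewrite leqn0 => /eqP ->|exact: h].
exact: prob_cylinder_tail.
Qed.

End PathLaw.

Section Marginal.
Variables (R : realType) (d : measure_display) (T : measurableType d).
Variables (P : probability T R) (N : nat).
Variables (Y : nat -> T -> 'I_N) (A : 'M[R]_N) (mu : 'I_N -> R).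
Hypothesis chain : stationary_reversible_chain P Y A mu.

(** The event [Y i = b] is written as a tail event whose only nonzero summand is
the indicator of [b] at time [i]; its backward recursion is then a power of the
transition matrix, under which [mu] is stationary. *)
Lemma marginal i b : P [set t | Y i t = b] = (mu b)%:E.
Proof.
have A_stoch := src_stochastic chain.
pose g j a : int := ((j == i) && (a == b))%:R.
have -> : [set t | Y i t = b] = tail_event Y g i.+1 0 1.
  apply/seteqP; split=> t; rewrite /tail_event /= add0n big_nat_recr //= big_nat_cond big1 ?add0r.
  - by move=> ->; rewrite /g !eqxx.
  - by move=> j; rewrite andbT => /andP[_ ji]; rewrite /g ltn_eqF.
  - by rewrite /g eqxx /=; case: eqP.
  - by move=> j; rewrite andbT => /andP[_ ji]; rewrite /g ltn_eqF.
rewrite (prob_tail_event chain); congr EFin.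
suff h k j : (j + k)%N = i ->
    mean mu (fun a => backward A g (fun y => (y == 0)%:R) k.+1 j a 1) = mu b.
  exact: h.
elim: k j => [|k IH] j jk.
  rewrite addn0 in jk; rewrite /mean (bigD1 b) //= big1 => [|a ab].
    rewrite addr0 /transition -mulr_suml A_stoch.2 /g jk !eqxx.
    by rewrite !mulr1.
  by rewrite /transition -mulr_suml /g jk eqxx (negbTE ab) /= !mulr0.
rewrite -(IH j.+1) ?addSnnS // -[RHS](mean_transition A_stoch (src_reversible chain)).
apply: eq_mean => a; rewrite [LHS]/=; apply: eq_bigr => c _.
by rewrite /g ltn_eqF ?subr0 // -jk addnS ltnS leq_addr.
Qed.

Lemma mean_eq0_of_expectation i (h : 'I_N -> R) :
  ('E_P[fun t => h (Y i t)] = 0)%E -> mean mu h = 0.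
Proof.
rewrite (expectation_discrete P h (src_rv chain i)) => e.
apply: EFin_inj; apply: etrans e; rewrite /mean -sumEFin; apply: eq_bigr => a _.
by rewrite marginal -EFinM mulrC.
Qed.

End Marginal.

(** * Concentration *)

(** The [v i], and the sums of two of them, lie strictly between 0 and [p], where
reduction modulo [p] is injective. *)
Lemma intr_Fp_distinct (n p : nat) (v : 'I_n -> int) : prime p ->
  (forall i, 1 <= v i) -> injective v -> (forall i, (2 * `|v i|%N < p)%N) ->
  injective (fun i => (v i)%:~R : 'F_p) /\
  forall i j, (v i)%:~R + (v j)%:~R != 0 :> 'F_p.
Proof.
move=> p_prime v1 v_inj vp.
have vlt i : (`|v i| < p)%N by have := vp i; lia.
have vE i : v i = Posz `|v i|%N by rewrite gez0_abs // (le_trans _ (v1 i)).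
split=> [i j|i j].
  move=> /(congr1 val) /=; rewrite (vE i) (vE j) -!pmulrn !val_Fp_nat // => e.
  apply: v_inj; rewrite (vE i) (vE j); congr Posz.
  by move: e; rewrite !modn_small.
rewrite (vE i) (vE j) -!pmulrn -natrD; apply/eqP => /(congr1 val) /=.
rewrite val_Fp_nat // modn_small; last by have := vp i; have := vp j; lia.
by have := v1 i; lia.
Qed.

Lemma powR_three_halves (R : realType) (x : R) : 0 < x -> x `^ (3 / 2) = x * Num.sqrt x.
Proof.
move=> x0; rewrite (_ : 3 / 2 = 1 + 2^-1); last by field.
by rewrite powRD ?gt_eqF ?implybT // powRr1 ?ltW // powR12_sqrt ?ltW.
Qed.

Section Concentration.
Variables (R : realType) (N n : nat) (A : 'M[R]_N) (mu : 'I_N -> R).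
Hypothesis n_gt0 : (0 < n)%N.
Hypothesis mu_prob : prob_vector mu.
Hypothesis A_stoch : stochastic A.
Hypothesis A_rev : reversible A mu.
Let lambda := L2opnorm mu (A - averaging mu).
Variables (g s : nat -> 'I_N -> int) (v : nat -> int).
Hypothesis gE : forall i a, (i < n)%N -> g i a = s i a * v i.
Hypothesis s_sign : forall i a, (i < n)%N -> s i a = -1 \/ s i a = 1.
Hypothesis s_mean : forall i, (i < n)%N -> mean mu (fun a => (s i a)%:~R) = 0.
Hypothesis v_ge1 : forall i : 'I_n, 1 <= v i.
Hypothesis v_inj : injective (fun i : 'I_n => v i).

(** The spectral and the arithmetic estimate combined; the constant is the product
of theirs. *)
Lemma mean_backward_indicator x : lambda < 1 ->
  mean mu (fun a => backward A g (fun y => (y == 0)%:R) n 0 a x)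
  <= 144 * 576 / (1 - lambda) ^+ 2 / (n%:R * Num.sqrt n%:R).
Proof.
move=> lt1.
have [p ltMp p_prime] := prime_above (2 * n ^ 2 + 2 * \sum_(i < n) `|v i|)%N.
have np : (2 * n ^ 2 <= p)%N by apply: leq_trans (ltnW ltMp); exact: leq_addr.
have vp i : (2 * `|v (i : 'I_n)| < p)%N.
  apply: leq_ltn_trans ltMp; apply: leq_trans (leq_addl _ _).
  by rewrite leq_mul2l (bigD1 i) //= leq_addr.
have [w_inj w_add] := intr_Fp_distinct p_prime v_ge1 v_inj vp.
have p0 : 0 < p%:R :> R by rewrite ltr0n prime_gt0.
pose zetas (theta : 'F_p) (y : int) : R := cosF R (theta * y%:~R).
apply: (@le_trans _ _ (mean mu (fun a => p%:R^-1 *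
   \sum_(theta : 'F_p) backward A g (zetas theta) n 0 a x))).
  apply: ler_mean => [|a]; first exact: mu_prob.1.
  apply: ler_backward_sum; first exact: A_stoch.1.
  move=> y; apply: le_trans (indicator_le_cosF R p_prime y%:~R).
  by rewrite ler_nat; case: eqP => [->|//]; rewrite eqxx.
rewrite meanZ.
have -> : mean mu (fun a => \sum_(theta : 'F_p) backward A g (zetas theta) n 0 a x)
    = \sum_(theta : 'F_p) mean mu (fun a => backward A g (zetas theta) n 0 a x).
  rewrite /mean exchange_big; apply: eq_bigr => a _; by rewrite mulr_sumr.
pose K : R := 144 / (1 - lambda) ^+ 2.
have K0 : 0 <= K by rewrite divr_ge0 ?ler0n ?sqr_ge0.
have bound : \sum_(theta : 'F_p) mean mu (fun a => backward A g (zetas theta) n 0 a x)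
   <= K * (576 * p%:R / (n%:R * Num.sqrt n%:R)).
  apply: (@le_trans _ _ (\sum_(theta : 'F_p) K *
      (1 + energy R (fun j : 'I_n => (v j)%:~R) theta) ^- 2)).
    apply: ler_sum => theta _.
    exact: (mean_backward_cos mu_prob A_stoch A_rev p_prime gE s_sign s_mean).
  rewrite -mulr_sumr ler_wpM2l //.
  exact: (@sum_inv_energy R p p_prime n _ n_gt0 w_inj w_add np).
apply: (@le_trans _ _ (p%:R^-1 * (K * (576 * p%:R / (n%:R * Num.sqrt n%:R))))).
  by rewrite ler_wpM2l // invr_ge0 ltW.
rewrite le_eqVlt /K; apply/orP; left; apply/eqP.
by field; rewrite !gt_eqF ?subr_gt0 ?sqrtr_gt0 ?p0 ?ltr0n.
Qed.

End Concentration.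

(* Division is that of \bar R, where C%:E / 0 = +oo for C > 0; this covers
   the case where the operator norm equals 1. *)
Theorem theorem1p3 (R : realType) :
  exists C : R, 0 < C /\
  forall (N n : nat), (1 <= N)%N -> (1 <= n)%N ->
  forall (d : measure_display) (T : measurableType d) (P : probability T R)
    (Y : nat -> T -> 'I_N) (A : 'M[R]_N) (mu : 'I_N -> R),
  stationary_reversible_chain P Y A mu ->
  let lambda := L2opnorm mu (A - averaging mu) in
  forall f : 'I_n -> 'I_N -> int,
  (forall i a, f i a = -1 \/ f i a = 1) ->
  (forall i : 'I_n, 'E_P[fun t => (f i (Y i t))%:~R] = 0)%E ->
  forall v : 'I_n -> int,
  (forall i, 1 <= v i) -> injective v ->
  forall x0 : int,
  (P [set t | (\sum_(i < n) f i (Y i t) * v i)%R = x0]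
     <= C%:E / ((1 - lambda) ^+ 3 * n%:R `^ (3 / 2))%:E)%E.
Proof.
have C0 : 0 < 144 * 576 :> R by rewrite -natrM ltr0n.
exists (144 * 576); split=> [//|].
move=> N n N1 n1 d T P Y A mu chain lambda f f_sign f_mean v v1 v_inj x0.
have [_ A_stoch mu_prob A_rev _ _] := chain.
have l0 : 0 <= lambda := opnorm_ge0 mu_prob A_stoch A_rev.
have : lambda <= 1 := opnorm_le1 mu_prob A_stoch A_rev.
rewrite le_eqVlt => /orP[/eqP -> | lt1].
  by rewrite subrr expr0n mul0r inve0 mulry (gtr0_sg C0) mul1e leey.
have nR : (0 : R) < n%:R by rewrite ltr0n.
have gap : 0 < 1 - lambda by rewrite subr_gt0.
pose s (i : nat) a : int := if insub i is Some j then f j a else 0.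
pose w (i : nat) : int := if insub i is Some j then v j else 0.
have sE (i : 'I_n) a : s i a = f i a by rewrite /s valK.
have wE (i : 'I_n) : w i = v i by rewrite /w valK.
have -> : [set t | (\sum_(i < n) f i (Y i t) * v i)%R = x0]
    = tail_event Y (fun i a => s i a * w i) n 0 x0.
  rewrite /tail_event; apply/seteqP; split=> t /= <-; rewrite add0n big_mkord;
    by apply: eq_bigr => i _; rewrite sE wE.
rewrite (prob_tail_event chain) inver mulf_eq0 expf_eq0 /= !gt_eqF ?powR_gt0 //.
rewrite -EFinM lee_fin.
apply: le_trans (mean_backward_indicator n1 mu_prob A_stoch A_rev _ _ _ _ _ x0 lt1) _.
- by [].
- by move=> i a ilt; rewrite -[i]/(val (Ordinal ilt)) sE.
- move=> i ilt; apply: (mean_eq0_of_expectation chain (i := i)); rewrite -[RHS](f_mean (Ordinal ilt)).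
  by congr expectation; apply/funext => t; rewrite -[X in s X]/(val (Ordinal ilt)) sE.
- by move=> i; rewrite wE.
- by move=> i j; rewrite !wE; exact: v_inj.
rewrite (powR_three_halves nR) -[leLHS]mulrA -invfM.
apply: ler_wpM2l; first exact: ltW.
have r0 : 0 < n%:R * Num.sqrt n%:R :> R by rewrite mulr_gt0 ?sqrtr_gt0.
rewrite -/lambda lef_pV2 ?posrE ?(mulr_gt0 _ r0) ?exprn_gt0 //.
apply: ler_wpM2r; first exact: ltW.
by rewrite exprS ler_piMl ?sqr_ge0 // gerBl.
Qed.
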